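(* There is an algorithm with running time $O(n^4)$ which, given an arbitrary $n\times n$ matrix $M$ with entries in $\mathbb{Z}_2$, computes a number $k$ such that $k/2\le R(M)\le k$.
   Context: For an $n\times n$ matrix $M$ with entries in $\mathbb{Z}_2$, $R(M)$ denotes the minimal rank (over $\mathbb{Z}_2$) among all matrices obtained from $M$ by changing some (possibly none) of the entries on the main diagonal of $M$, i.e. $R(M)=\min\{\operatorname{rk}(M+D): D \text{ an } n\times n \text{ diagonal matrix over } \mathbb{Z}_2\}$. Complexity is measured in elementary operations on entries of $\mathbb{Z}_2$. *)

(* Defs.v *)
From mathcomp Require Import all_boot all_order all_algebra.
Set Implicit Arguments. Unset Strict Implicit. Unset Printing Implicit Defensive.
Import GRing.Theory.

Definition Rmin (n : nat) (M : 'M['F_2]_n) : nat :=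
  \big[minn/n]_(d : 'rV['F_2]_n) \rank (M + diag_mx d)%R.

(* A structured while-language over:
   - nat registers  (indices/counters), named by nat literals,
   - bit registers  (elements of Z_2 as bool), named by nat literals,
   - 2D bit arrays  (array name is a literal, indices come from nat registers).
   Every elementary operation costs one step (including each test of a
   conditional or loop guard). Only +, truncated -, comparison on nat
   registers (no unit-cost multiplication), and XOR/AND on bits. *)

Inductive cond : Type :=
  | CLt  (x y : nat)
  | CEq  (x y : nat)
  | CBit (p : nat).

Inductive cmd : Type :=
  | Skip
  | NSet  (x c : nat)
  | NAdd  (x y z : nat)
  | NSub  (x y z : nat)
  | BConst (p : nat) (c : bool)
  | BXor  (p q s : nat)
  | BAnd  (p q s : nat)
  | BLoad (p arr x y : nat)
  | BStore (arr x y p : nat)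
  | Seq (c1 c2 : cmd)
  | If (g : cond) (c1 c2 : cmd)
  | While (g : cond) (c : cmd).

Record mstate : Type := MState {
  nreg : nat -> nat;
  breg : nat -> bool;
  arrs : nat -> nat -> nat -> bool }.

Definition evalc (g : cond) (s : mstate) : bool :=
  match g with
  | CLt x y => nreg s x < nreg s y
  | CEq x y => nreg s x == nreg s y
  | CBit p => breg s p
  end.

Definition upd_n (s : mstate) (x v : nat) : mstate :=
  MState (fun z => if z == x then v else nreg s z) (breg s) (arrs s).
Definition upd_b (s : mstate) (p : nat) (v : bool) : mstate :=
  MState (nreg s) (fun z => if z == p then v else breg s z) (arrs s).
Definition upd_a (s : mstate) (a i j : nat) (v : bool) : mstate :=
  MState (nreg s) (breg s)
    (fun a' i' j' => if [&& a' == a, i' == i & j' == j] then v else arrs s a' i' j').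

Inductive exec : cmd -> mstate -> nat -> mstate -> Prop :=
  | ESkip s : exec Skip s 0 s
  | ENSet s x c : exec (NSet x c) s 1 (upd_n s x c)
  | ENAdd s x y z : exec (NAdd x y z) s 1 (upd_n s x (nreg s y + nreg s z))
  | ENSub s x y z : exec (NSub x y z) s 1 (upd_n s x (nreg s y - nreg s z))
  | EBConst s p c : exec (BConst p c) s 1 (upd_b s p c)
  | EBXor s p q r : exec (BXor p q r) s 1 (upd_b s p (breg s q (+) breg s r))
  | EBAnd s p q r : exec (BAnd p q r) s 1 (upd_b s p (breg s q && breg s r))
  | EBLoad s p a x y :
      exec (BLoad p a x y) s 1 (upd_b s p (arrs s a (nreg s x) (nreg s y)))
  | EBStore s a x y p :
      exec (BStore a x y p) s 1 (upd_a s a (nreg s x) (nreg s y) (breg s p))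
  | ESeq s1 s2 s3 c1 c2 t1 t2 :
      exec c1 s1 t1 s2 -> exec c2 s2 t2 s3 -> exec (Seq c1 c2) s1 (t1 + t2) s3
  | EIfT s s' g c1 c2 t :
      evalc g s -> exec c1 s t s' -> exec (If g c1 c2) s t.+1 s'
  | EIfF s s' g c1 c2 t :
      ~~ evalc g s -> exec c2 s t s' -> exec (If g c1 c2) s t.+1 s'
  | EWhileF s g c :
      ~~ evalc g s -> exec (While g c) s 1 s
  | EWhileT s1 s2 s3 g c t1 t2 :
      evalc g s1 -> exec c s1 t1 s2 -> exec (While g c) s2 t2 s3 ->
      exec (While g c) s1 (t1 + t2).+1 s3.

Definition init_state (n : nat) (M : 'M['F_2]_n) : mstate :=
  MState (fun x => if x == 0 then n else 0) (fun _ => false)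
    (fun a i j =>
       if a == 0 then
         match @insub _ _ 'I_n i, @insub _ _ 'I_n j with
         | Some i', Some j' => M i' j' == 1%R
         | _, _ => false
         end
       else false).

Definition output (s : mstate) : nat := nreg s 0.

(* Main.v *)
(* Scan the rows r_1, ..., r_n of M, keeping a set Z of selected indices and the
   span W of the vectors r_z and e_z for z in Z; select i exactly when r_i is not
   in W + <e_i>.  Whatever the diagonal matrix D, each selected row of M + D lies
   outside the span of the previously selected ones, so R(M) >= |Z|.  Each other
   row lies in W after a suitable choice of its diagonal entry, so
   R(M) <= dim W <= 2|Z|.  Hence k = 2|Z| is a valid answer.  Membership in W is
   decided with a table holding at most one vector for each leading position. *)
Require Import Defs.
From mathcomp Require Import all_boot all_order all_algebra.
From mathcomp Require Import zify.
Set Implicit Arguments. Unset Strict Implicit. Unset Printing Implicit Defensive.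
Import GRing.Theory.

(** * Total correctness with a cost bound *)

(** The existential run carries termination with it. [T] is only an upper bound on the cost, so
    bounds may be rounded up through [wp_leq]. *)
Definition wp (c : cmd) (T : nat) (Q : mstate -> Prop) (s : mstate) : Prop :=
  exists t s', exec c s t s' /\ t <= T /\ Q s'.

Lemma wp_mono c T (Q Q' : mstate -> Prop) s :
  wp c T Q s -> (forall s', Q s' -> Q' s') -> wp c T Q' s.
Proof. by move=> [t [s' [E [le_t q]]]] imp; exists t, s'; do 2!split=> //; apply: imp. Qed.

Lemma wp_leq c T T' (Q : mstate -> Prop) s : wp c T Q s -> T <= T' -> wp c T' Q s.
Proof.
move=> [t [s' [E [le_t q]]]] leT; exists t, s'; do 2!split=> //; exact: leq_trans leT.
Qed.

Lemma wp_skip (Q : mstate -> Prop) s : Q s -> wp Skip 0 Q s.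
Proof. by move=> q; exists 0, s; split=> //; constructor. Qed.

Lemma wp_nset x c (Q : mstate -> Prop) s : Q (upd_n s x c) -> wp (NSet x c) 1 Q s.
Proof. by move=> q; do 2 eexists; split; first exact: ENSet. Qed.

Lemma wp_nadd x y z (Q : mstate -> Prop) s :
  Q (upd_n s x (nreg s y + nreg s z)) -> wp (NAdd x y z) 1 Q s.
Proof. by move=> q; do 2 eexists; split; first exact: ENAdd. Qed.

Lemma wp_bconst p b (Q : mstate -> Prop) s : Q (upd_b s p b) -> wp (BConst p b) 1 Q s.
Proof. by move=> q; do 2 eexists; split; first exact: EBConst. Qed.

Lemma wp_bxor p q r (Q : mstate -> Prop) s :
  Q (upd_b s p (breg s q (+) breg s r)) -> wp (BXor p q r) 1 Q s.
Proof. by move=> h; do 2 eexists; split; first exact: EBXor. Qed.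

Lemma wp_bload p a x y (Q : mstate -> Prop) s :
  Q (upd_b s p (arrs s a (nreg s x) (nreg s y))) -> wp (BLoad p a x y) 1 Q s.
Proof. by move=> q; do 2 eexists; split; first exact: EBLoad. Qed.

Lemma wp_bstore a x y p (Q : mstate -> Prop) s :
  Q (upd_a s a (nreg s x) (nreg s y) (breg s p)) -> wp (BStore a x y p) 1 Q s.
Proof. by move=> q; do 2 eexists; split; first exact: EBStore. Qed.

Lemma wp_seq c1 c2 T1 T2 Q s :
  wp c1 T1 (wp c2 T2 Q) s -> wp (Seq c1 c2) (T1 + T2) Q s.
Proof.
move=> [t1 [s1 [E1 [le1 [t2 [s2 [E2 [le2 q]]]]]]]].
exists (t1 + t2), s2; split; first exact: ESeq E1 E2.
by split=> //; apply: leq_add.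
Qed.

(** Adding the costs of both branches, instead of taking the larger one, loses at most a constant
    factor. *)
Lemma wp_if g c1 c2 T1 T2 (Q : mstate -> Prop) s :
  (evalc g s -> wp c1 T1 Q s) -> (~~ evalc g s -> wp c2 T2 Q s) ->
  wp (If g c1 c2) (T1 + T2).+1 Q s.
Proof.
case: (boolP (evalc g s)) => hg h1 h2.
  have [t [s' [E [le q]]]] := h1 isT; exists t.+1, s'; split; first exact: EIfT.
  by split=> //; lia.
have [t [s' [E [le q]]]] := h2 isT; exists t.+1, s'; split; first exact: EIfF.
by split=> //; lia.
Qed.

(* Array [aW] is the table of W, [aB] a working copy of it, and [aV] a vector in
   its row 0; register [rZero] is never written. *)
Local Notation rN := 0 (only parsing).
Local Notation rOne := 1 (only parsing).
Local Notation rK := 2 (only parsing).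
Local Notation rP := 3 (only parsing).
Local Notation rJ := 4 (only parsing).
Local Notation rCnt := 5 (only parsing).
Local Notation rZero := 6 (only parsing).
Local Notation rFlag := 7 (only parsing).
Local Notation aM := 0 (only parsing).
Local Notation aW := 1 (only parsing).
Local Notation aB := 2 (only parsing).
Local Notation aV := 3 (only parsing).

Definition For (x : nat) (body : cmd) : cmd :=
  Seq (NSet x 0) (While (CLt x rN) (Seq body (NAdd x x rOne))).

(** Each round costs [T] plus one guard test and one increment; the two extra units are the
    initialisation and the failing last test. The invariant must fix [rN] and the counter, since the
    guard reads both. *)
Lemma wp_for x body T n (I : nat -> mstate -> Prop) s :
  (forall i s, I i s -> nreg s rN = n /\ nreg s x = i) ->
  (forall i s, i < n -> I i s ->
     wp body T (fun s' => I i.+1 (upd_n s' x (nreg s' x + nreg s' rOne))) s) ->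
  I 0 (upd_n s x 0) ->
  wp (For x body) (1 + (n * (T + 2) + 1)) (I n) s.
Proof.
move=> Ireg step I0; apply/wp_seq/wp_nset.
(* Induction on the number [m] of rounds left, with the counter value [i] generalized. *)
suff loop m i s0 : i + m = n -> I i s0 ->
    wp (While (CLt x rN) (Seq body (NAdd x x rOne))) (m * (T + 2) + 1) (I n) s0.
  exact: (loop n 0 (upd_n s x 0)).
elim: m i s0 => [|m IHm] i {I0}s def_n Ii; have [eN ei] := Ireg _ _ Ii.
  rewrite addn0 in def_n; rewrite -def_n; exists 1, s; split=> //; apply: EWhileF.
  by rewrite /= eN ei; lia.
have lt_in : i < n by lia.
have [t1 [s1 [E1 [le1 I1]]]] := step i s lt_in Ii.
have [|t2 [s2 [E2 [le2 q]]]] := IHm i.+1 _ _ I1; first by lia.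
exists ((t1 + 1) + t2).+1, s2; split; last by split=> //; lia.
apply: EWhileT E2; first by rewrite /= eN ei.
exact: ESeq E1 (ENAdd _ _ _ _).
Qed.

Definition store_row (pre : cmd) (a x : nat) : cmd :=
  For rJ (Seq pre (BStore a x rJ 0)).

(** When [pre] runs for column [j], that column still has its original content in every array. Hence
    [pre] may read the very row that the loop overwrites, as [reduce_row] does. *)
Lemma wp_store_row n pre a x T (f : nat -> bool) s :
  x != rJ -> nreg s rN = n -> nreg s rOne = 1 ->
  (forall s1 j, j < n -> nreg s1 rJ = j ->
     (forall y, y != rJ -> nreg s1 y = nreg s y) ->
     (forall b i, arrs s1 b i j = arrs s b i j) ->
     wp pre T (fun s' => [/\ nreg s' = nreg s1, arrs s' = arrs s1
                           & breg s' 0 = f j]) s1) ->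
  wp (store_row pre a x) (1 + (n * (T + 1 + 2) + 1))
    (fun s' => (forall y, y != rJ -> nreg s' y = nreg s y) /\
       (forall b i j, arrs s' b i j =
          if [&& b == a, i == nreg s x & j < n] then f j else arrs s b i j)) s.
Proof.
move=> xJ sN sOne Hpre.
pose I m s' := [/\ nreg s' rJ = m, forall y, y != rJ -> nreg s' y = nreg s y
  & forall b i j, arrs s' b i j =
      if [&& b == a, i == nreg s x & j < m] then f j else arrs s b i j].
apply: (@wp_mono _ _ (I n)); last by move=> s' [_ h1 h2].
rewrite /store_row; apply: (wp_for (I := I)) => [i s1 [h1 h2 h3]|i s1 lt_in [h1 h2 h3]|].
- by rewrite h2.
- apply: wp_seq; apply: wp_mono.
    by apply: (Hpre _ i) => // b i'; rewrite h3 ltnn !andbF.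
  move=> s2 [e1 e2 e3]; apply: wp_bstore; split=> /=.
  + by rewrite e1 h1 h2 // sOne addn1.
  + by move=> y yJ; rewrite (negbTE yJ) e1 h2.
  + move=> b i' j; rewrite e1 e2 e3 (h2 _ xJ) h1 h3 ltnS.
    case: (b == a) => //=; case: (i' == _) => //=.
    by case: (ltngtP j i) => [||->].
- split=> //= [y yJ|b i j]; first by rewrite (negbTE yJ).
  by rewrite !andbF.
Qed.

(** * Insertion into an echelon table *)

(* Row [p] of the table is either zero or the unique row with leading position [p]. *)
Definition echelon (F : fieldType) (n : nat) (B : 'M[F]_n) : Prop :=
  (forall i j : 'I_n, j < i -> B i j = 0%R) /\
  (forall i : 'I_n, B i i = 0%R -> row i B = 0%R).

(** If [v] were a combination of the rows with coefficients [c], its zero coordinates before [p]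
    would, one after the other, make each term [c_i *: row i B] vanish. Coordinate [p] would then be
    [c_p * B p p = 0]. *)
Lemma echelon_notin (F : fieldType) n (B : 'M[F]_n) (v : 'rV[F]_n) (p : 'I_n) :
  echelon B -> (forall q : 'I_n, q < p -> v ord0 q = 0%R) -> v ord0 p != 0%R ->
  B p p = 0%R -> ~~ (v <= B)%MS.
Proof.
move=> [tri diag] v0 vp Bpp; apply/negP => /submxP[c def_v].
(* In column [q], rows after [q] vanish by triangularity and rows before [q] by assumption, so only
   the diagonal term is left. *)
have coef (q : 'I_n) : (forall i : 'I_n, i < q -> (c ord0 i *: row i B = 0)%R) ->
    v ord0 q = (c ord0 q * B q q)%R.
  move=> small; rewrite def_v mxE (bigD1 q) //= big1 ?addr0 // => i i_q.
  have [lt_iq|lt_qi|/val_inj e] := ltngtP i q; last by rewrite e eqxx in i_q.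
    by have /matrixP/(_ ord0 q) := small i lt_iq; rewrite !mxE.
  by rewrite tri ?mulr0.
(* Strong induction on [i], run through the bound [m]. A zero product means a zero coefficient or a
   zero pivot, and a zero pivot means a zero row. *)
have small m (i : 'I_n) : i < m -> i < p -> (c ord0 i *: row i B = 0)%R.
  elim: m i => // m IHm i; rewrite ltnS => le_im lt_ip.
  have := coef i (fun k lt_ki => IHm k (leq_trans lt_ki le_im) (ltn_trans lt_ki lt_ip)).
  rewrite v0 // => /esym/eqP; rewrite mulf_eq0 => /orP[/eqP->|/eqP/diag->].
    by rewrite scale0r.
  by rewrite scaler0.
by move: vp; rewrite (coef p) ?Bpp ?mulr0 ?eqxx // => i lt_ip; apply: (small p).
Qed.

Definition set_row (F : fieldType) n (B : 'M[F]_n) (p : 'I_n) (v : 'rV[F]_n) : 'M[F]_n :=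
  \matrix_(i, j) if i == p then v ord0 j else B i j.

Lemma row_set_row (F : fieldType) n (B : 'M[F]_n) p v i :
  row i (set_row B p v) = if i == p then v else row i B.
Proof. by apply/rowP=> j; rewrite !mxE; case: eqP; rewrite ?mxE. Qed.

Lemma echelon_set_row (F : fieldType) n (B : 'M[F]_n) (p : 'I_n) (v : 'rV[F]_n) :
  echelon B -> (forall q : 'I_n, q < p -> v ord0 q = 0%R) -> v ord0 p != 0%R ->
  echelon (set_row B p v).
Proof.
move=> [tri diag] v0 vp; split=> [i j lt_ji|i].
  by rewrite mxE; case: eqP => [e|_]; [rewrite v0 -?e | exact: tri].
by rewrite row_set_row mxE; case: eqP => [->|_]; [move/eqP; rewrite (negbTE vp) | exact: diag].
Qed.

Lemma set_row_span (F : fieldType) n (B : 'M[F]_n) (p : 'I_n) (v : 'rV[F]_n) :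
  row p B = 0%R -> (set_row B p v :=: B + v)%MS.
Proof.
move=> Bp0; apply/eqmxP/andP; split.
  apply/row_subP=> i; rewrite row_set_row; case: eqP => _; first exact: addsmxSr.
  by apply: submx_trans (row_sub _ _) (addsmxSl _ _).
rewrite addsmx_sub; apply/andP; split.
  apply/row_subP=> i; have [->|ip] := eqVneq i p; first by rewrite Bp0 sub0mx.
  by have := row_sub i (set_row B p v); rewrite row_set_row (negbTE ip).
by have := row_sub p (set_row B p v); rewrite row_set_row eqxx.
Qed.

(** * The greedy bound *)

Lemma Rmin_le n (M : 'M['F_2]_n) (d : 'rV['F_2]_n) :
  Rmin M <= \rank (M + diag_mx d)%R.
Proof.
rewrite /Rmin; have := mem_index_enum d; elim: (index_enum _) => // x r IHr.
rewrite in_cons big_cons => /predU1P[->|/IHr]; first exact: geq_minl.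
by apply: leq_trans; apply: geq_minr.
Qed.

(** The condition [g <= n] covers the default value [n] of the iterated minimum. *)
Lemma Rmin_ge n (M : 'M['F_2]_n) g :
  g <= n -> (forall d, g <= \rank (M + diag_mx d)%R) -> g <= Rmin M.
Proof.
by move=> le_gn ge; rewrite /Rmin; elim/big_ind: _ => // x y gx gy; rewrite leq_min gx.
Qed.

(* [W] is spanned by the rows [z] of [M] and the vectors [e_z], for the [g] selected [z < k]. *)
Definition greedy_inv (F : fieldType) n (M : 'M[F]_n) (k : nat) (W : 'M[F]_n) (g : nat) : Prop :=
  [/\ \rank W <= 2 * g,
      forall i : 'I_n, i < k -> exists c, ((row i M + c *: delta_mx ord0 i)%R <= W)%MS
    & forall d, exists U : 'M[F]_n,
        [/\ (U <= W)%MS, (U <= (M + diag_mx d)%R)%MS & g <= \rank U]].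

Lemma greedy_init (F : fieldType) n (M : 'M[F]_n) : greedy_inv M 0 0%R 0.
Proof. by split=> [||d]; rewrite ?mxrank0 //; exists 0%R; rewrite !sub0mx. Qed.

(** With [v = e_k], the scalar found is the change of the diagonal entry that brings row [k] into
    [W]. *)
Lemma sub_adds_rV (F : fieldType) n (W : 'M[F]_n) (u v : 'rV[F]_n) :
  (u <= W + v)%MS -> exists c, ((u + c *: v)%R <= W)%MS.
Proof.
case/sub_addsmxP=> -[w c] /= ->; exists (- c ord0 ord0)%R.
have -> : (c *m v = c ord0 ord0 *: v)%R.
  by rewrite [c in LHS]mx11_scalar mul_scalar_mx.
by rewrite scaleNr addrK submxMl.
Qed.

Lemma row_diag_mx (F : fieldType) n (d : 'rV[F]_n) (k : 'I_n) :
  row k (diag_mx d) = (d ord0 k *: delta_mx ord0 k)%R.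
Proof.
by apply/rowP=> j; rewrite !mxE eqxx /= [j == k]eq_sym; case: (k == j);
   rewrite ?mulr1 ?mulr0.
Qed.

Lemma greedy_skip (F : fieldType) n (M : 'M[F]_n) (k : 'I_n) W g :
  greedy_inv M k W g -> (row k M <= W + (delta_mx ord0 k : 'rV_n))%MS -> greedy_inv M k.+1 W g.
Proof.
move=> [rW compl indep] /sub_adds_rV kW; split=> // i.
by rewrite ltnS leq_eqVlt => /predU1P[/val_inj->|/compl].
Qed.

(** The two new generators raise the rank by at most 2. For any [d], row [k] of [M + diag_mx d] lies
    in [W'] and can be added to [U]. It is not already in [U], which is inside [W]: subtracting its
    multiple of [e_k] would put [row k M] in [W + e_k]. *)
Lemma greedy_add (F : fieldType) n (M : 'M[F]_n) (k : 'I_n) W W' g :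
  greedy_inv M k W g -> ~~ (row k M <= W + (delta_mx ord0 k : 'rV_n))%MS ->
  (W' :=: W + (delta_mx ord0 k : 'rV_n) + row k M)%MS -> greedy_inv M k.+1 W' g.+1.
Proof.
move=> [rW compl indep] kW W'E.
have sWW' : (W <= W')%MS by rewrite W'E -addsmxA addsmxSl.
have sdW' : ((delta_mx ord0 k : 'rV_n) <= W')%MS.
  by rewrite W'E; apply: submx_trans (addsmxSr _ _) (addsmxSl _ _).
have srW' : (row k M <= W')%MS by rewrite W'E addsmxSr.
split.
- rewrite W'E; apply: leq_trans (mxrank_adds_leqif _ _) _.
  apply: leq_trans (leq_add (mxrank_adds_leqif _ _) (rank_leq_row _)) _.
  apply: leq_trans (leq_add (leq_add rW (rank_leq_row _)) (leqnn _)) _; lia.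
- move=> i; rewrite ltnS leq_eqVlt => /predU1P[/val_inj->|/compl[c h]]; last first.
    by exists c; apply: submx_trans sWW'.
  (* The new row is itself in [W'], so its diagonal entry stays unchanged. *)
  by exists 0%R; rewrite scale0r addr0.
- move=> d; have [U [sUW sUM rU]] := indep d.
  have rkE : row k (M + diag_mx d)%R = (row k M + d ord0 k *: delta_mx ord0 k)%R.
    by rewrite -row_diag_mx; apply/rowP=> j; rewrite !mxE.
  exists (U + row k (M + diag_mx d)%R)%MS; split.
  + rewrite addsmx_sub (submx_trans sUW sWW') rkE.
    by rewrite addmx_sub // scalemx_sub.
  + by rewrite addsmx_sub sUM row_sub.
  + apply: leq_ltn_trans rU (rank_ltmx _); rewrite ltmxE addsmxSl /=.
    apply: contra kW; rewrite addsmx_sub submx_refl /= => skU.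
    have -> : row k M = (row k (M + diag_mx d) - d ord0 k *: delta_mx ord0 k)%R.
      by rewrite rkE addrK.
    apply: addmx_sub; last by rewrite eqmx_opp; apply/scalemx_sub/addsmxSr.
    exact: submx_trans (submx_trans skU sUW) (addsmxSl _ _).
Qed.

(** The spaces [U] bound every rank from below. For the upper bound, the scalars chosen row by row
    form one diagonal matrix that brings all rows into [W]. *)
Lemma greedy_bounds n (M : 'M['F_2]_n) W g :
  greedy_inv M n W g -> 2 * g <= 2 * Rmin M /\ Rmin M <= 2 * g.
Proof.
move=> [rW compl indep]; split.
  rewrite leq_mul2l /=; apply: Rmin_ge => [|d].
    by have [U [_ _ rU]] := indep 0%R; apply: leq_trans rU (rank_leq_row _).
  by have [U [_ sUM rU]] := indep d; apply: leq_trans rU (mxrankS sUM).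
have /fin_all_exists[c hc] (i : 'I_n) : exists c, ((row i M + c *: delta_mx ord0 i)%R <= W)%MS.
  exact: compl.
apply: leq_trans (Rmin_le M (\row_i c i)%R) (leq_trans (mxrankS _) rW).
apply/row_subP=> i; have -> : row i (M + diag_mx (\row_i c i))%R =
    (row i M + c i *: delta_mx ord0 i)%R.
  have -> : c i = (\row_i c i)%R ord0 i by rewrite mxE.
  by rewrite -row_diag_mx; apply/rowP=> j; rewrite !mxE.
exact: hc.
Qed.

(** * Loop invariant of an insertion *)

Definition insert_inv (F : fieldType) n (B0 : 'M[F]_n) (v0 : 'rV[F]_n)
    (p : nat) (B : 'M[F]_n) (v : 'rV[F]_n) (placed : bool) : Prop :=
  [/\ echelon B, (B + v :=: B0 + v0)%MS,
      forall q : 'I_n, q < p -> v ord0 q = 0%R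
    & if placed then v = 0%R /\ ~~ (v0 <= B0)%MS
      else B = B0 /\ ((v0 - v)%R <= B0)%MS].

Lemma insert_stay (F : fieldType) n (B0 B : 'M[F]_n) v0 v placed (p : 'I_n) :
  insert_inv B0 v0 p B v placed -> v ord0 p = 0%R -> insert_inv B0 v0 p.+1 B v placed.
Proof.
move=> [ech span low fl] vp; split=> // q.
by rewrite ltnS leq_eqVlt => /predU1P[/val_inj->|/low].
Qed.

(** Adding the row with pivot [p] clears coordinate [p] and, by triangularity, leaves the earlier
    zeros intact. A nonzero [v] rules out that the vector was already placed. *)
Lemma insert_reduce (F : fieldType) n (B0 B : 'M[F]_n) v0 v placed (p : 'I_n) :
  insert_inv B0 v0 p B v placed -> v ord0 p != 0%R -> (v ord0 p + B p p = 0)%R ->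
  insert_inv B0 v0 p.+1 B (v + row p B)%R placed.
Proof.
move=> [ech span low fl] vp vBp; have [tri _] := ech; split=> //.
- apply: eqmx_trans span; apply/eqmxP/andP; split; rewrite addsmx_sub addsmxSl /=.
    by rewrite addmx_sub ?addsmxSr // (submx_trans (row_sub _ _)) ?addsmxSl.
  rewrite -[X in (X <= _)%MS](addrK (row p B)) addmx_sub ?addsmxSr //.
  by rewrite eqmx_opp (submx_trans (row_sub _ _)) ?addsmxSl.
- move=> q; rewrite ltnS leq_eqVlt !mxE => /predU1P[/val_inj->//|lt_qp].
  by rewrite low ?tri ?addr0.
- case: placed fl => [[v_0 _]|[-> sv]]; first by rewrite v_0 mxE eqxx in vp.
  by split=> //; rewrite opprD addrA addmx_sub // eqmx_opp row_sub.
Qed.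

(** By [echelon_notin] the remainder [v] is outside the table, and [v0] differs from [v] by an
    element of the span of [B0], so [v0] is outside too. *)
Lemma insert_place (F : fieldType) n (B0 B : 'M[F]_n) v0 v placed (p : 'I_n) :
  insert_inv B0 v0 p B v placed -> v ord0 p != 0%R -> B p p = 0%R ->
  insert_inv B0 v0 p.+1 (set_row B p v) 0%R true.
Proof.
move=> [ech span low fl] vp Bpp; have [_ diag] := ech; split.
- exact: echelon_set_row.
- apply: eqmx_trans span; apply: eqmx_trans (set_row_span _ (diag p Bpp)).
  exact: addsmx0.
- by move=> q _; rewrite mxE.
- split=> //; case: placed fl => [[v_0 _]|[BE sv]]; first by rewrite v_0 mxE eqxx in vp.
  apply: contra (echelon_notin ech low vp Bpp) => v0B; rewrite BE.
  by rewrite -[v](subKr v0) addmx_sub // eqmx_opp.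
Qed.

(** After all [n] positions the remainder is zero. The span clause then gives the new span, and the
    flag decides membership of [v0]. *)
Lemma insert_final (F : fieldType) n (B0 B : 'M[F]_n) v0 v placed :
  insert_inv B0 v0 n B v placed ->
  [/\ echelon B, (B :=: B0 + v0)%MS & placed = ~~ (v0 <= B0)%MS].
Proof.
move=> [ech span low fl].
have v_0 : v = 0%R by apply/rowP=> q; rewrite low // mxE.
split=> //; last first.
  by case: placed fl => [[_ ->]//|[_]]; rewrite v_0 subr0 => ->.
by apply: eqmx_trans span; rewrite v_0; apply: eqmx_sym; apply: addsmx0.
Qed.

(** * The program *)

Definition table (n : nat) (s : mstate) (a : nat) : 'M['F_2]_n :=
  (\matrix_(i, j) (arrs s a i j : nat)%:R)%R.
Definition vect (n : nat) (s : mstate) : 'rV['F_2]_n :=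
  (\row_j (arrs s aV 0 j : nat)%:R)%R.

(** A frame condition: only the listed registers may change. Bit registers get none, being scratch
    that every routine sets before reading. *)
Definition same_nreg (xs : seq nat) (s s' : mstate) : Prop :=
  forall y, y \notin xs -> nreg s' y = nreg s y.
Definition same_arrs (bs : seq nat) (s s' : mstate) : Prop :=
  forall b, b \notin bs -> forall i j, arrs s' b i j = arrs s b i j.

Lemma table_same n bs s s' a : same_arrs bs s s' -> a \notin bs -> table n s' a = table n s a.
Proof. by move=> sa ha; apply/matrixP=> i j; rewrite !mxE sa. Qed.

Lemma F2_nat_addb (b c : bool) :
  (((b (+) c : bool) : nat)%:R = (b : nat)%:R + (c : nat)%:R :> 'F_2)%R.
Proof. by apply/eqP; case: b; case: c. Qed.

Lemma F2_nat_eq1 (x : 'F_2) : (((x == 1%R) : nat)%:R = x)%R.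
Proof. by apply/eqP; case: x => [[|[|]]]. Qed.

Definition reduce_row : cmd :=
  store_row (Seq (BLoad 0 aV rZero rJ) (Seq (BLoad 1 aB rP rJ) (BXor 0 0 1))) aV rZero.
(** Clearing the vector after the move makes the rest of the scan inert. *)
Definition place_row : cmd :=
  Seq (store_row (BLoad 0 aV rZero rJ) aB rP)
  (Seq (store_row (BConst 0 false) aV rZero)
       (NSet rFlag 1)).
Definition insert : cmd :=
  Seq (NSet rFlag 0)
  (For rP (Seq (BLoad 0 aV rZero rP)
    (If (CBit 0)
       (Seq (BLoad 1 aB rP rP) (If (CBit 1) reduce_row place_row))
       Skip))).
Definition copy_table (a b : nat) : cmd :=
  For rP (store_row (BLoad 0 a rP rJ) b rP).
Definition load_unit : cmd :=
  Seq (store_row (BConst 0 false) aV rZero)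
  (Seq (BConst 0 true) (BStore aV rZero rK 0)).
Definition load_row : cmd := store_row (BLoad 0 aM rK rJ) aV rZero.
(** The work is done on the copy [aB], so a row that is not selected leaves [aW] intact. As [insert]
    resets [rFlag], the final test sees only the second insertion, that of [r_k] into [W + e_k]. *)
Definition greedy_step : cmd :=
  Seq (copy_table aW aB)
  (Seq load_unit
  (Seq insert
  (Seq load_row
  (Seq insert
       (If (CEq rFlag rOne)
           (Seq (copy_table aB aW) (NAdd rCnt rCnt rOne))
           Skip))))).
Definition minrank_approx : cmd :=
  Seq (NSet rOne 1) (Seq (For rK greedy_step) (NAdd rN rCnt rCnt)).

(** * Correctness and cost of the routines *)

Lemma wp_reduce_row n (p : 'I_n) s :
  nreg s rN = n -> nreg s rOne = 1 -> nreg s rZero = 0 -> nreg s rP = p ->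
  wp reduce_row (6 * n + 2)
    (fun s' => [/\ same_nreg [:: rJ] s s', same_arrs [:: aV] s s'
       & vect n s' = (vect n s + row p (table n s aB))%R]) s.
Proof.
move=> sN s1 sZ sP; apply: wp_leq; last first.
  (* The sum built by the cost rules: two loads, a xor, a store and two units of loop overhead per
     column. *)
  instantiate (1 := 1 + (n * (1 + (1 + 1) + 1 + 2) + 1)); lia.
apply: wp_mono.
  apply: (@wp_store_row n _ _ _ _ (fun j => arrs s aV 0 j (+) arrs s aB p j)) => // s2 j _ h2 h3 h4.
  apply/wp_seq/wp_bload/wp_seq/wp_bload/wp_bxor; split=> //=.
  by rewrite h2 !h3 // sZ sP !h4.
move=> s2 [h1 h2]; split.
- by move=> y; rewrite inE => /h1.
- by move=> b; rewrite inE => /negbTE hb i j; rewrite h2 hb.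
- by apply/rowP=> j; rewrite !mxE h2 sZ /= ltn_ord F2_nat_addb.
Qed.

Lemma wp_place_row n (p : 'I_n) s :
  nreg s rN = n -> nreg s rOne = 1 -> nreg s rZero = 0 -> nreg s rP = p ->
  wp place_row (8 * n + 5)
    (fun s' => [/\ same_nreg [:: rJ; rFlag] s s', same_arrs [:: aB; aV] s s',
       nreg s' rFlag = 1, vect n s' = 0%R
       & table n s' aB = set_row (table n s aB) p (vect n s)]) s.
Proof.
move=> sN s1 sZ sP; apply: wp_leq; last first.
  instantiate (1 := 1 + (n * (1 + 1 + 2) + 1) + (1 + (n * (1 + 1 + 2) + 1) + 1)); lia.
apply: wp_seq; apply: wp_mono.
  apply: (@wp_store_row n _ _ _ _ (fun j => arrs s aV 0 j)) => // s2 j _ h2 h3 h4.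
  by apply/wp_bload; split=> //=; rewrite h3 // h2 sZ h4.
move=> s2 [h1 h2]; apply: wp_seq; apply: wp_mono.
  apply: (@wp_store_row n _ _ _ _ (fun=> false)); rewrite ?h1 // => s3 j _ h3 h4 h5.
  exact: wp_bconst.
move=> s3 [h3 h4]; apply: wp_nset; split=> //=.
- by move=> y; rewrite !inE => /norP[yJ /negbTE /= ->]; rewrite h3 ?h1.
- by move=> b; rewrite !inE => /norP[/negbTE h6 /negbTE h7] i j /=; rewrite h4 h7 h2 h6.
- by apply/rowP=> j; rewrite !mxE /= h4 h1 // sZ ltn_ord.
- apply/matrixP=> i j; rewrite !mxE /= h4 /= h2 /= sP ltn_ord andbT val_eqE.
  by case: (i == p).
Qed.

(** Each of the [n] positions triggers at most one row operation of linear cost. The coefficient 14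
    is 6 + 8, from the two branches added by [wp_if]. *)
Lemma wp_insert n s :
  nreg s rN = n -> nreg s rOne = 1 -> nreg s rZero = 0 -> echelon (table n s aB) ->
  wp insert (14 * n ^ 2 + 13 * n + 3)
    (fun s' => [/\ same_nreg [:: rP; rJ; rFlag] s s', same_arrs [:: aB; aV] s s',
       nreg s' rFlag = ~~ (vect n s <= table n s aB)%MS,
       echelon (table n s' aB)
       & (table n s' aB :=: table n s aB + vect n s)%MS]) s.
Proof.
move=> sN s1 sZ ech; apply: wp_leq; last first.
  instantiate (1 := 1 + (1 + (n * (1 +
    ((1 + (6 * n + 2 + (8 * n + 5)).+1) + 0).+1 + 2) + 1))); lia.
pose I p s' := [/\ nreg s' rP = p, same_nreg [:: rP; rJ; rFlag] s s',
  same_arrs [:: aB; aV] s s' & exists2 placed : bool, nreg s' rFlag = placed &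
    insert_inv (table n s aB) (vect n s) p (table n s' aB) (vect n s') placed].
apply: wp_seq; apply: wp_nset; apply: (@wp_mono _ _ (I n)); last first.
  move=> s2 [_ h2 h3 [placed -> /insert_final[h4 h5 ->]]].
  by split; [exact: h2 | exact: h3 | | |].
apply: (wp_for (I := I)).
- by move=> i s2 [h1 h2 _ _]; rewrite h2.
- move=> i s2 lt_in [h1 h2 h3 [placed h4 h5]].
  pose p := Ordinal lt_in.
  have [gN [gO gZ]] : nreg s2 rN = n /\ nreg s2 rOne = 1 /\ nreg s2 rZero = 0.
    by rewrite !h2.
  have vpE : vect n s2 ord0 p = (arrs s2 aV 0 i : nat)%:R%R by rewrite mxE.
  have BpE : table n s2 aB p p = (arrs s2 aB i i : nat)%:R%R by rewrite mxE.
  apply: wp_seq; apply: wp_bload; rewrite gZ h1; apply: wp_if => /= vp.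
    apply: wp_seq; apply: wp_bload; rewrite /= h1; apply: wp_if => /= Bp.
      apply: wp_mono; first exact: (@wp_reduce_row n p).
      move=> s3 [k1 k2 k3]; split=> /=.
      + by rewrite !k1 //= h1 gO addn1.
      + move=> y hy /=; rewrite !inE !negb_or in hy; case/and3P: hy => y1 y2 y3.
        by rewrite (negbTE y1) k1 ?inE //= h2 // !inE !negb_or y1 y2.
      + move=> b hb i' j /=; rewrite k2; last by move: hb; rewrite !inE negb_or => /andP[].
        exact: h3.
      + exists placed; first by rewrite /= k1.
        (* The counter increment leaves the arrays alone, so the table and the vector agree by
           conversion. *)
        change (insert_inv (table n s aB) (vect n s) i.+1 (table n s3 aB) (vect n s3) placed).
        rewrite (table_same n k2) // k3.
        (* Both bits are 1 here, and [1 + 1 = 0] in ['F_2]. *)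
        by apply: (insert_reduce (p := p)) => //; rewrite vpE ?BpE ?vp ?Bp //; apply/eqP.
    apply: wp_mono; first exact: (@wp_place_row n p).
    move=> s3 [k1 k2 k3 k4 k5]; split=> /=.
    + by rewrite !k1 //= h1 gO addn1.
    + move=> y hy /=; rewrite !inE !negb_or in hy; case/and3P: hy => y1 y2 y3.
      by rewrite (negbTE y1) k1 ?inE ?negb_or ?y2 //= h2 // !inE !negb_or y1 y2.
    + by move=> b hb i' j /=; rewrite k2 // -(h3 b hb).
    + exists true; first by rewrite /= k3.
      change (insert_inv (table n s aB) (vect n s) i.+1 (table n s3 aB) (vect n s3) true).
      rewrite k4 k5.
      by apply: (insert_place (p := p) h5); rewrite ?vpE ?BpE ?vp ?(negbTE Bp).
  apply: wp_skip; split=> //=.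
  + by rewrite h1 gO addn1.
  + move=> y hy /=; have := hy; rewrite !inE !negb_or => /and3P[/negbTE-> _ _].
    exact: h2.
  + exists placed => //; apply: (insert_stay (p := p) h5).
    by rewrite vpE (negbTE vp).
- split=> //=.
  + by move=> y; rewrite /= !inE !negb_or => /and3P[/negbTE-> _ /negbTE->].
  + exists false => //; split=> //; split=> //.
    by rewrite subrr sub0mx.
Qed.

Lemma wp_copy_table n a b s :
  a != b -> nreg s rN = n -> nreg s rOne = 1 ->
  wp (copy_table a b) (4 * n ^ 2 + 4 * n + 2)
    (fun s' => [/\ same_nreg [:: rP; rJ] s s', same_arrs [:: b] s s'
       & table n s' b = table n s a]) s.
Proof.
move=> ab sN s1; apply: wp_leq; last first.
  instantiate (1 := 1 + (n * (1 + (n * (1 + 1 + 2) + 1) + 2) + 1)); lia.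
pose I m s' := [/\ nreg s' rP = m, same_nreg [:: rP; rJ] s s', same_arrs [:: b] s s'
  & forall i j, i < m -> j < n -> arrs s' b i j = arrs s a i j].
apply: (@wp_mono _ _ (I n)); last first.
  move=> s2 [_ h1 h2 h3]; split; [exact: h1 | exact: h2 |].
  by apply/matrixP=> i j; rewrite !mxE h3.
apply: (wp_for (I := I)).
- by move=> i s2 [h1 h2 _ _]; rewrite h2.
- move=> i s2 lt_in [h1 h2 h3 h4]; apply: wp_mono.
    apply: (@wp_store_row n _ _ _ _ (fun j => arrs s a i j)); rewrite ?h2 //.
    move=> s3 j lt_jn h5 h6 h7; apply: wp_bload; split=> //=.
    by rewrite h6 // h1 h5 h7 h3 // inE.
  move=> s3 [h5 h6]; split=> /=.
  + by rewrite !h5 // h1 h2 // s1 addn1.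
  + move=> y hy /=; have := hy; rewrite !inE negb_or => /andP[/negbTE-> yJ].
    by rewrite h5 // h2.
  + move=> c hc i' j /=; have := hc; rewrite !inE => /negbTE cb.
    by rewrite h6 cb h3.
  + move=> i' j /=; rewrite ltnS leq_eqVlt => /predU1P[->|lt_i'] lt_jn; rewrite h6 h1 eqxx /=.
      by rewrite eqxx lt_jn.
    by rewrite (ltn_eqF lt_i') /= h4.
- by split=> //= y; rewrite !inE negb_or => /andP[/negbTE/= ->].
Qed.

Lemma wp_load_unit n (k : 'I_n) s :
  nreg s rN = n -> nreg s rOne = 1 -> nreg s rZero = 0 -> nreg s rK = k ->
  wp load_unit (4 * n + 4)
    (fun s' => [/\ same_nreg [:: rJ] s s', same_arrs [:: aV] s s'
       & vect n s' = delta_mx ord0 k]) s.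
Proof.
move=> sN s1 sZ sK; apply: wp_leq; last first.
  instantiate (1 := 1 + (n * (1 + 1 + 2) + 1) + (1 + 1)); lia.
apply: wp_seq; apply: wp_mono.
  by apply: (@wp_store_row n _ _ _ _ (fun=> false)) => // s3 j _ h3 h4 h5; apply: wp_bconst.
move=> s2 [h1 h2]; apply/wp_seq/wp_bconst/wp_bstore; split=> /=.
- by move=> y; rewrite inE => /h1.
- by move=> b; rewrite inE => /negbTE hb i j /=; rewrite hb h2 hb.
- apply/rowP=> j; rewrite !mxE /= !h1 // sZ sK /= h2 sZ /= ltn_ord val_eqE.
  by case: (j == k).
Qed.

Lemma wp_load_row n (k : 'I_n) s :
  nreg s rN = n -> nreg s rOne = 1 -> nreg s rZero = 0 -> nreg s rK = k ->
  wp load_row (4 * n + 2)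
    (fun s' => [/\ same_nreg [:: rJ] s s', same_arrs [:: aV] s s'
       & vect n s' = row k (table n s aM)]) s.
Proof.
move=> sN s1 sZ sK; apply: wp_leq; last first.
  instantiate (1 := 1 + (n * (1 + 1 + 2) + 1)); lia.
apply: wp_mono.
  apply: (@wp_store_row n _ _ _ _ (fun j => arrs s aM k j)) => // s2 j _ h2 h3 h4.
  by apply: wp_bload; split=> //=; rewrite h3 // h2 sK h4.
move=> s2 [h1 h2]; split.
- by move=> y; rewrite inE => /h1.
- by move=> b; rewrite inE => /negbTE hb i j; rewrite h2 hb.
- by apply/rowP=> j; rewrite !mxE h2 sZ /= ltn_ord.
Qed.

(** * The main loop and the final bound *)

Definition main_inv n (M : 'M['F_2]_n) (k : nat) (s : mstate) : Prop :=
  [/\ nreg s rN = n, nreg s rOne = 1, nreg s rZero = 0 & nreg s rK = k] /\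
  [/\ table n s aM = M, echelon (table n s aW)
    & greedy_inv M k (table n s aW) (nreg s rCnt)].

Lemma wp_greedy_step n (M : 'M['F_2]_n) (k : 'I_n) s :
  main_inv M k s ->
  wp greedy_step (36 * n ^ 2 + 42 * n + 19)
    (fun s' => main_inv M k.+1 (upd_n s' rK (nreg s' rK + nreg s' rOne))) s.
Proof.
move=> [[sN s1 sZ sK] [sM ech inv]]; apply: wp_leq; last first.
  instantiate (1 := 4 * n ^ 2 + 4 * n + 2 + (4 * n + 4 + (14 * n ^ 2 + 13 * n + 3 +
    (4 * n + 2 + (14 * n ^ 2 + 13 * n + 3 +
    (4 * n ^ 2 + 4 * n + 2 + 1 + 0).+1))))); lia.
apply: wp_seq; apply: wp_mono; first exact: (@wp_copy_table n).
move=> s2 [a1 a2 a3]; apply: wp_seq; apply: wp_mono.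
  by apply: (@wp_load_unit n k); rewrite a1.
move=> s3 [b1 b2 b3]; apply: wp_seq; apply: wp_mono.
  by apply: (@wp_insert n); rewrite ?b1 ?a1 // (table_same n b2) // a3.
rewrite b3 (table_same n b2) // a3.
(* The first flag is dropped: whether [e_k] already lay in [W] is immaterial. *)
move=> s4 [c1 c2 _ c4 c5]; apply: wp_seq; apply: wp_mono.
  by apply: (@wp_load_row n k); rewrite ?c1 ?b1 ?a1.
rewrite (table_same n c2) // (table_same n b2) // (table_same n a2) // sM.
move=> s5 [d1 d2 d3]; apply: wp_seq; apply: wp_mono.
  by apply: (@wp_insert n); rewrite ?d1 ?c1 ?b1 ?a1 // (table_same n d2).
rewrite d3 (table_same n d2) //.
move=> s6 [e1 e2 e3 e4 e5].
have tabM : table n s6 aM = M.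
  by rewrite (table_same n e2) ?(table_same n d2) ?(table_same n c2)
    ?(table_same n b2) ?(table_same n a2).
have tabW : table n s6 aW = table n s aW.
  by rewrite (table_same n e2) ?(table_same n d2) ?(table_same n c2)
    ?(table_same n b2) ?(table_same n a2).
have reg y : y \notin [:: rP; rJ; rFlag] -> nreg s6 y = nreg s y.
  rewrite !inE !negb_or => /and3P[y1 y2 y3].
  by rewrite e1 ?d1 ?c1 ?b1 ?a1 // !inE ?negb_or ?y1 ?y2 ?y3.
(* By [c5], the span tested by the second insertion is [W + e_k], so the flag is exactly the
   selection criterion. *)
apply: wp_if => /=; rewrite e3 (reg rOne) // s1 eqb1 c5 ?negbK => rowM.
  apply: wp_seq; apply: wp_mono; first by apply: (@wp_copy_table n); rewrite ?reg.
  move=> s7 [f1 f2 f3]; apply: wp_nadd; split.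
    by split; rewrite /= f1 ?reg ?sK ?f1 ?reg ?s1 ?addn1.
  split=> /=.
  + by change (table n s7 aM = M); rewrite (table_same n f2).
  + by change (echelon (table n s7 aW)); rewrite f3.
  + change (greedy_inv M k.+1 (table n s7 aW) (nreg s7 rCnt + nreg s7 rOne)).
    rewrite !f1 // !reg // s1 addn1 f3; apply: greedy_add inv rowM _.
    by apply: eqmx_trans e5 _; apply: adds_eqmx.
apply: wp_skip; split; first by split; rewrite /= ?reg // sK s1 addn1.
split=> /=; rewrite ?reg //.
- by change (echelon (table n s6 aW)); rewrite tabW.
- change (greedy_inv M k.+1 (table n s6 aW) (nreg s rCnt)).
  by rewrite tabW; apply: greedy_skip.
Qed.

Lemma table_init n (M : 'M['F_2]_n) : table n (init_state M) aM = M.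
Proof. by apply/matrixP=> i j; rewrite mxE /= !valK F2_nat_eq1. Qed.

Lemma table_init0 n (M : 'M['F_2]_n) a : a != aM -> table n (init_state M) a = 0%R.
Proof. by move=> /negbTE a0; apply/matrixP=> i j; rewrite !mxE /= a0. Qed.

Theorem theorem2 :
  exists (P : cmd) (C : nat),
    forall (n : nat) (M : 'M['F_2]_n),
      exists (t : nat) (s' : mstate),
        exec P (init_state M) t s' /\
        t <= C * n ^ 4 + C /\
        output s' <= 2 * Rmin M /\ Rmin M <= output s'.
Proof.
(* The certified cost is [36 n^3 + 42 n^2 + 21 n + 4], which is even cubic; 150 is a generous
   constant. *)
exists minrank_approx, 150 => n M.
suff [t [s' [E [le_t [W [g [outE inv]]]]]]] : wp minrank_approx (150 * n ^ 4 + 150)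
    (fun s => exists W g, output s = 2 * g /\ greedy_inv M n W g) (init_state M).
  by exists t, s'; do 2!split=> //; rewrite outE; apply: greedy_bounds inv.
apply: wp_leq; last first.
  instantiate (1 := 1 + (1 + (n * (36 * n ^ 2 + 42 * n + 19 + 2) + 1) + 1)).
  (* Smaller powers are absorbed into [n ^ 4], which uses [0 < n]; the case [n = 0] is separate. *)
  have pow i : 0 < n -> i <= 4 -> n ^ i <= n ^ 4 by move=> *; apply: leq_pexp2l.
  case: (posnP n) => [->//|n_gt0].
  have := pow 1 n_gt0 isT; have := pow 2 n_gt0 isT; have := pow 3 n_gt0 isT; lia.
apply: wp_seq; apply: wp_nset; apply: wp_seq; apply: (@wp_mono _ _ (main_inv M n)).
  apply: (wp_for (I := main_inv M)).
  - by move=> i s [[]].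
  - by move=> i s lt_in; apply: (@wp_greedy_step n M (Ordinal lt_in)).
  - split=> //; split=> /=; first exact: table_init.
      change (echelon (table n (init_state M) aW)); rewrite table_init0 //.
      by split=> [i j _|i _]; rewrite ?mxE // row0.
    change (greedy_inv M 0 (table n (init_state M) aW) 0).
    by rewrite table_init0 //; apply: greedy_init.
move=> s [_ [_ _ inv]]; apply: wp_nadd; exists (table n s aW), (nreg s rCnt).
by split=> //; rewrite /output /= addnn mul2n.
Qed.
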